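(* Let $p$ be an odd prime. Then $W_1=w_p$ in $\mathbf F_p$, and for $1<k<p$, $$W_k=\frac{B_{p-k}}{k}\qquad\text{in }\mathbf F_p.$$
   Context: $p$ is an odd prime. The Artin--Hasse exponential is $\operatorname{AH}_p(X)=\exp\left(\sum_{i\ge0}X^{p^i}/p^i\right)=\sum_{n\ge0}u_nX^n\in\mathbf Z_p[[X]]$, $a_n\in\mathbf F_p$ is the reduction of $u_n$ modulo $p$, and $$W_k=\sum_{r=0}^k(-1)^r r\,a_{rp}a_{(k-r)p}\in\mathbf F_p.$$ $w_p=\frac{(p-1)!+1}{p}\bmod p$ is the Wilson quotient. $B_n$ are the Bernoulli numbers with $B_1=-1/2$; $B_n$ is $p$-integral for $1\le n\le p-2$ and is regarded as an element of $\mathbf F_p$ by reduction modulo $p$. *)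

(* Defs.v *)
From mathcomp Require Import all_boot all_order all_algebra.

Set Implicit Arguments.
Unset Strict Implicit.
Unset Printing Implicit Defensive.

Import GRing.Theory Num.Theory.
Local Open Scope ring_scope.

(* Power series over the rationals are handled through their truncations:    *)
(* AH_log_trunc p N keeps the terms i <= N of \sum_i X^(p^i) / p^i, and      *)
(* AH_trunc p N is its exponential series cut after the N-th power.  For     *)
(* p > 1 the discarded terms only contribute in degrees > N (AH_truncE), so  *)
(* AH_coef p n is the coefficient u_n of the full series AH_p(X).            *)
Definition AH_log_trunc (p N : nat) : {poly rat} :=
  \sum_(i < N.+1) ((p ^ i)%N%:R)^-1 *: 'X^(p ^ i).

Definition AH_trunc (p N : nat) : {poly rat} :=
  \sum_(j < N.+1) (j`!%:R)^-1 *: AH_log_trunc p N ^+ j.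

Definition AH_coef (p n : nat) : rat := (AH_trunc p n)`_n.

Lemma AH_log_trunc_split (p n N : nat) : (1 < p)%N -> (n <= N)%N ->
  exists Q : {poly rat},
    AH_log_trunc p N = AH_log_trunc p n + Q * 'X^(n.+1).
Proof.
move=> p1 /subnKC <-; elim: (N - n)%N => [|d [Q IH]].
  by exists 0; rewrite addn0 mul0r addr0.
rewrite addnS /AH_log_trunc big_ord_recr /= -/(AH_log_trunc p (n + d)) IH.
set m := (n + d).+1.
have le_n : (n.+1 <= p ^ m)%N.
  by apply: leq_trans (ltnW (ltn_expl m p1)); rewrite ltnS leq_addr.
exists (Q + ((p ^ m)%N%:R)^-1 *: 'X^(p ^ m - n.+1)).
by rewrite mulrDl -scalerAl -exprD subnK // addrA.
Qed.

Lemma AH_log_trunc_dvdX (p N : nat) : (1 < p)%N ->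
  exists Q : {poly rat}, AH_log_trunc p N = Q * 'X.
Proof.
move=> p1; exists (\sum_(i < N.+1) ((p ^ i)%N%:R)^-1 *: 'X^((p ^ i).-1)).
rewrite mulr_suml; apply: eq_bigr => i _.
by rewrite -scalerAl -exprSr prednK // expn_gt0 (ltnW p1).
Qed.

Lemma AH_truncE (p n N : nat) : (1 < p)%N -> (n <= N)%N ->
  (AH_trunc p N)`_n = AH_coef p n.
Proof.
move=> p1 le_nN.
have [Q defL] := AH_log_trunc_split p1 le_nN.
have same j : (AH_log_trunc p N ^+ j)`_n = (AH_log_trunc p n ^+ j)`_n.
  apply/eqP; rewrite -subr_eq0 -coefB subrXX {1}defL addrC addKr.
  by rewrite -mulrA -commr_polyXn mulrA coefMXn ltnSn.
have high j : (n < j)%N -> (AH_log_trunc p N ^+ j)`_n = 0.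
  have [R ->] := AH_log_trunc_dvdX N p1.
  by move=> lt_nj; rewrite exprMn coefMXn lt_nj.
rewrite /AH_coef /AH_trunc !coef_sum -(subnKC le_nN) -addSn big_split_ord /=.
rewrite [X in _ + X]big1 ?addr0 => [|i _].
  by apply: eq_bigr => j _; rewrite !coefZ subnKC // same.
by rewrite coefZ subnKC // high ?mulr0 // addSn ltnS leq_addr.
Qed.

(* On p-integral rationals ratr : rat -> 'F_p is reduction modulo p.  It is  *)
(* a total function (with value 0 when p divides the denominator), but it is *)
(* only applied to u_n and to B_n with 1 <= n <= p - 2, all p-integral.      *)
Definition red_modp (p : nat) (x : rat) : 'F_p := ratr x.

Definition AH_coef_modp (p n : nat) : 'F_p := red_modp p (AH_coef p n).

Definition W (p k : nat) : 'F_p :=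
  \sum_(r < k.+1)
    (-1) ^+ r * r%:R * AH_coef_modp p (r * p) * AH_coef_modp p ((k - r) * p).

(* The division is exact when p is prime, by Wilson's theorem.               *)
Definition wilson_quotient (p : nat) : 'F_p :=
  (((p.-1)`! + 1) %/ p)%N%:R.

(* bernoulli_seq n = [:: B_0; ...; B_n], computed from B_0 = 1 and           *)
(* \sum_(i <= n) 'C(n + 1, i) B_i = 0 for n > 0, so that B_1 = - 1/2.        *)
Fixpoint bernoulli_seq (n : nat) : seq rat :=
  if n is m.+1 then
    let s := bernoulli_seq m in
    rcons s (- (n.+1%:R)^-1 * \sum_(i < n) 'C(n.+1, i)%:R * s`_i)
  else [:: 1].

Definition bernoulli (n : nat) : rat := (bernoulli_seq n)`_n.

Lemma size_bernoulli_seq (n : nat) : size (bernoulli_seq n) = n.+1.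
Proof. by elim: n => //= n IH; rewrite size_rcons IH. Qed.

Lemma nth_bernoulli_seq (n i : nat) : (i <= n)%N ->
  (bernoulli_seq n)`_i = bernoulli i.
Proof.
elim: n => [|n IH]; first by rewrite leqn0 => /eqP ->.
rewrite leq_eqVlt => /predU1P[-> //|lt_in].
by rewrite /= nth_rcons size_bernoulli_seq lt_in IH.
Qed.

Lemma bernoulli_rec (n : nat) :
  \sum_(i < n.+1) 'C(n.+1, i)%:R * bernoulli i = (n == 0%N)%:R.
Proof.
case: n => [|n]; first by rewrite big_ord1 mul1r.
rewrite big_ord_recr /= {2}/bernoulli /= nth_rcons size_bernoulli_seq.
rewrite ltnn eqxx binSn mulNr mulrN mulVKf; last by rewrite pnatr_eq0.
apply/eqP; rewrite subr_eq0; apply/eqP/eq_bigr => i _.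
by rewrite nth_bernoulli_seq // -ltnS.
Qed.

Lemma bernoulli1 : bernoulli 1 = - 2^-1.
Proof. by rewrite /bernoulli /= big_ord1 bin0 !mulr1. Qed.

(* Main.v *)
Require Import Defs.
From mathcomp Require Import all_boot all_order all_algebra.
From mathcomp Require Import finfield ring zify.

Set Implicit Arguments.
Unset Strict Implicit.
Unset Printing Implicit Defensive.

Import GRing.Theory Num.Theory.
Local Open Scope ring_scope.

(** Write R(x) = x(x+1)...(x+p-1). Modulo p it is x^p - x, so
R = x^p - x + p Q with Q in Z[x] of degree less than p ([wilson_poly]); the
coefficient of x in Q is ((p-1)!+1)/p.  Everything is read off from Q mod p.

Artin-Hasse side.  For r < p only exp(X) exp(X^p/p) contributes to
u_(rp), so u_(rp) is the sum over i of 1/(ip)! times the coefficient of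
Y^(r-i) in exp(Y/p) ([AH_coef_moment]).  Inserting the weight (-ip)^m gives the
moment M_m(r), and the weight R(-ip) = -(ip)!/(ip-p)! turns the sum into minus
the one for r - 1; so the moments satisfy a linear relation with the
coefficients of R ([moment_rising], [moment_main]).  As
M_(m+1)(r) = M_m(r-1) - pr M_m(r), the moment M_m(r) reduces to u_((r-m)p)
modulo p, which gives both the p-integrality of u_(rp) for r < p and, for
A(x) = sum_r a_(rp) x^r, the differential equation
x A' = - Q A modulo x^p ([AH_block_ode]).

The evaluations p Q(-j) = j^p - j for 0 <= j < p imply
Q(x) + Q(-x) = - x^(p-1) modulo p ([wilson_modp_sym]).  Hence A(x) A(-x) is
constant up to degree p - 2, and W_k, which is the coefficient of x^k in
A(x) x d/dx A(-x), equals that of - Q(-x): W_k = (-1)^(k+1) Q_k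
([W_wilson_modp]).

Bernoulli side.  R(x+1) - R(x) = p R(x)/x; differentiating and dividing by p
gives G(x+1) - G(x) = - x^(p-2) modulo p for G = x^(p-1) + Q'
([wilson_modp_shift]).  This is the difference equation of the Bernoulli
polynomial B_(p-1), and comparing coefficients yields the recursion that
defines the Bernoulli numbers ([reduces_bernoulli]). *)

(** * Reduction modulo p of rational numbers *)

(** x is p-integral with residue y.  As a relation, it makes integrality and
the value of the residue propagate together through ring operations. *)
Definition reduces (p : nat) (x : rat) (y : 'F_p) : Prop :=
  exists a b : int, [/\ (b%:~R : 'F_p) != 0, x = a%:~R / b%:~R
                      & y = a%:~R / b%:~R].
Arguments reduces : clear implicits.

Section Reduction.
Variable p : nat.
Implicit Types (x : rat) (y : 'F_p).

Lemma intrF_neq0 (b : int) : (b%:~R : 'F_p) != 0 -> (b%:~R : rat) != 0.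
Proof. by apply: contraNneq => /eqP; rewrite intr_eq0 => /eqP->. Qed.

Lemma reduces_int (a : int) : reduces p a%:~R a%:~R.
Proof. by exists a, 1; rewrite !divr1 oner_eq0. Qed.

Lemma reduces_nat (n : nat) : reduces p n%:R n%:R.
Proof. exact: (reduces_int n). Qed.

Lemma reducesD x1 x2 y1 y2 :
  reduces p x1 y1 -> reduces p x2 y2 -> reduces p (x1 + x2) (y1 + y2).
Proof.
move=> [a [b [b0 -> ->]]] [c [d [d0 -> ->]]].
exists (a * d + c * b), (b * d).
rewrite !rmorphD !rmorphM /= mulf_neq0 // !addf_div //; exact: intrF_neq0.
Qed.

Lemma reducesM x1 x2 y1 y2 :
  reduces p x1 y1 -> reduces p x2 y2 -> reduces p (x1 * x2) (y1 * y2).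
Proof.
move=> [a [b [b0 -> ->]]] [c [d [d0 -> ->]]].
by exists (a * c), (b * d); rewrite !rmorphM /= mulf_neq0 // !mulf_div.
Qed.

Lemma reducesN x y : reduces p x y -> reduces p (- x) (- y).
Proof.
move=> xy; rewrite -mulN1r -[- y]mulN1r.
exact: reducesM (reduces_int (-1)) xy.
Qed.

Lemma reducesB x1 x2 y1 y2 :
  reduces p x1 y1 -> reduces p x2 y2 -> reduces p (x1 - x2) (y1 - y2).
Proof. by move=> h1 h2; apply: reducesD h1 (reducesN h2). Qed.

(** A p-integral rational with nonzero residue is a p-adic unit. *)
Lemma reducesV x y : y != 0 -> reduces p x y -> reduces p x^-1 y^-1.
Proof.
move=> y0 [a [b [b0 -> Dy]]]; exists b, a; rewrite Dy !invf_div; split=> //.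
by apply: contraNneq y0 => a0; rewrite Dy a0 mul0r.
Qed.

Lemma reduces_sum (I : finType) (P : pred I) (F : I -> rat) (G : I -> 'F_p) :
    (forall i, P i -> reduces p (F i) (G i)) ->
  reduces p (\sum_(i | P i) F i) (\sum_(i | P i) G i).
Proof.
move=> FG; elim/big_rec2: _ => [|i y x Pi]; first exact: (reduces_int 0).
exact/reducesD/FG.
Qed.

Lemma reduces_red_modp x y : reduces p x y -> red_modp p x = y.
Proof.
case=> a [b [b0 -> ->]]; rewrite /red_modp /ratr.
have := intrF_neq0 b0; case: divqP b0 => [_ | k r k0].
  by rewrite mulr0z eqxx.
rewrite !rmorphM /= mulf_eq0 negb_or => /andP[kF dF] _.
by rewrite -mulf_div divff // mul1r.
Qed.

Lemma reduces_inj x y1 y2 : reduces p x y1 -> reduces p x y2 -> y1 = y2.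
Proof. by move=> /reduces_red_modp <- /reduces_red_modp. Qed.

End Reduction.

(** * Arithmetic in the prime field *)

Section ModP.
Variables (p : nat) (p_prime : prime p).

Lemma Fp_natr0 : (p%:R : 'F_p) = 0.
Proof. exact: pcharf0 (pchar_Fp p_prime). Qed.

Lemma Fp_natr_neq0 n : (0 < n < p)%N -> (n%:R : 'F_p) != 0.
Proof.
by case/andP=> n0 lt_np; rewrite -(dvdn_pcharf (pchar_Fp p_prime)) gtnNdvd.
Qed.

Lemma reduces_pmul x y : reduces p x y -> reduces p (p%:R * x) 0.
Proof. by move/(reducesM (reduces_nat p p)); rewrite Fp_natr0 mul0r. Qed.

(** Pascal's rule, since the binomials C(p, n+1) vanish modulo p. *)
Lemma Fp_bin_pred n : (n < p)%N -> ('C(p.-1, n)%:R : 'F_p) = (-1) ^+ n.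
Proof.
elim: n => [|n IH] lt_np; first by rewrite bin0.
have p_gt0 := prime_gt0 p_prime.
have : ('C(p, n.+1)%:R : 'F_p) = 0.
  apply/eqP; rewrite -(dvdn_pcharf (pchar_Fp p_prime)).
  exact: prime_dvd_bin.
have -> : 'C(p, n.+1) = ('C(p.-1, n.+1) + 'C(p.-1, n))%N.
  by rewrite -binS (prednK p_gt0).
rewrite natrD IH ?(ltnW lt_np) // => /eqP.
by rewrite addr_eq0 => /eqP->; rewrite exprS mulN1r.
Qed.

Lemma Fp_natr_val (x : 'F_p) : (val x)%:R = x.
Proof. exact: natr_Zp. Qed.

Lemma Fp_val_lt (x : 'F_p) : (val x < p)%N.
Proof. by move: (ltn_ord x); rewrite [X in (_ < X)%N]Fp_cast. Qed.

Lemma Fp_fermat (x : 'F_p) : x ^+ p = x.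
Proof. by rewrite -[X in _ ^+ X](card_Fp p_prime) expf_card. Qed.

Lemma Fp_poly_eq0 (F : {poly 'F_p}) :
  (size F <= p)%N -> (forall x, F.[x] = 0) -> F = 0.
Proof.
move=> szF F0; apply: (@roots_geq_poly_eq0 _ F (enum 'F_p)).
- by apply/allP=> x _; apply/eqP.
- exact: enum_uniq.
by rewrite -cardE card_Fp.
Qed.

End ModP.

(** * Rising factorials and their Wilson quotients *)

Section PolyComposition.
Variable R : comNzRingType.
Implicit Types F : {poly R}.

Lemma coef_comp_opp F k : (F \Po (- 'X))`_k = (-1) ^+ k * F`_k.
Proof.
elim/poly_ind: F k => [|F c IH] k; first by rewrite comp_poly0 !coef0 mulr0.
rewrite comp_poly_MXaddC mulrN !(coefD, coefN, coefMX, coefC).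
by case: k => [|k] /=; rewrite ?IH ?exprS; ring.
Qed.

Lemma coef_comp_add1 F n k : (size F <= n)%N ->
  (F \Po ('X + 1))`_k = \sum_(m < n) F`_m * 'C(m, k)%:R.
Proof.
move=> szF; rewrite comp_polyE coef_sum.
rewrite (big_ord_widen n (fun m => (F`_m *: ('X + 1) ^+ m)`_k)) // big_mkcond.
apply: eq_bigr => m _ /=.
have -> : ('X + 1) ^+ m = \poly_(i < m.+1) 'C(m, i)%:R :> {poly R}.
  rewrite poly_def addrC exprDn; apply: eq_bigr => i _.
  by rewrite expr1n mul1r scaler_nat.
rewrite coefZ coef_poly; case: (ltnP m (size F)) => [_ | le_Fm]; last first.
  by rewrite nth_default // mul0r.
by case: ltnP => // lt_mk; rewrite bin_small.
Qed.

End PolyComposition.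

Section Rising.
Variable R : comNzRingType.

Definition rising n : {poly R} := \prod_(t < n) ('X + t%:R%:P).

(** The rising factorial started at X + 1, i.e. rising n.+1 divided by X. *)
Definition rising1 n : {poly R} := \prod_(t < n) ('X + t.+1%:R%:P).

Lemma risingS n : rising n.+1 = 'X * rising1 n.
Proof. by rewrite /rising big_ord_recl addr0. Qed.

Lemma rising_shift n : rising n \Po ('X + 1) = rising1 n.
Proof.
rewrite /rising rmorph_prod; apply: eq_bigr => t _ /=.
by rewrite comp_polyD comp_polyX comp_polyC -addrA -polyCD nat1r.
Qed.

Lemma rising_diff n :
  rising n.+1 \Po ('X + 1) - rising n.+1 = n.+1%:R *: rising1 n.
Proof.
rewrite rising_shift risingS /rising1 big_ord_recr /= -/(rising1 n).
by rewrite -mul_polyC; ring.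
Qed.

(** Both sides vanish for m < n: the product contains the factor with t = m. *)
Lemma horner_rising n m : (rising n).[- m%:R] = (-1) ^+ n * (m ^_ n)%:R.
Proof.
elim: n => [|n IH]; first by rewrite /rising big_ord0 hornerC mulr1.
rewrite /rising big_ord_recr /= -/(rising n) hornerM IH !hornerE ffactnSr natrM.
have [le_nm | lt_mn] := leqP n m; last by rewrite ffact_small //; ring.
by rewrite natrB // exprS; ring.
Qed.

Lemma size_rising n : size (rising n) = n.+1.
Proof.
rewrite /rising; under eq_bigr do rewrite -[_%:P]opprK -polyCN.
by rewrite size_prod_XsubC /index_enum -enumT size_enum_ord.
Qed.

Lemma rising_monic n : rising n \is monic.
Proof.
apply: monic_prod => t _; rewrite -[_%:P]opprK -polyCN; exact: monicXsubC.
Qed.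

Lemma size_rising_trunc n : (1 < n)%N -> (size (rising n - 'X^n + 'X)%R <= n)%N.
Proof.
move=> n_gt1; apply/leq_sizeP => j; rewrite leq_eqVlt => /predU1P[<- | lt_nj].
  have := monicP (rising_monic n); rewrite lead_coefE size_rising /= => Dn.
  by rewrite coefD coefB coefX coefXn Dn eqxx subrr add0r gtn_eqF.
rewrite coefD coefB coefX coefXn nth_default ?size_rising //.
by rewrite !gtn_eqF ?subr0 ?addr0 // (ltn_trans n_gt1).
Qed.

Lemma horner0_rising1 n : (rising1 n).[0] = n`!%:R.
Proof.
elim: n => [|n IH]; first by rewrite /rising1 big_ord0 hornerC.
rewrite /rising1 big_ord_recr /= -/(rising1 n) hornerM IH !hornerE.
by rewrite factS mulnC natrM.
Qed.

End Rising.

Lemma map_rising (R : comNzRingType) n :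
  map_poly (intr : int -> R) (rising _ n) = rising R n.
Proof.
rewrite rmorph_prod; apply: eq_bigr => t _ /=.
by rewrite rmorphD /= map_polyX map_polyC /= rmorph_nat.
Qed.

Lemma map_rising1 (R : comNzRingType) n :
  map_poly (intr : int -> R) (rising1 _ n) = rising1 R n.
Proof.
by rewrite -!rising_shift map_comp_poly rmorphD /= map_polyX rmorph1 map_rising.
Qed.

(** The difference of the two sides has degree less than p and vanishes at every
element of the field, by Fermat's little theorem. *)
Lemma rising_Fp p : prime p -> rising 'F_p p = 'X^p - 'X.
Proof.
move=> p_prime; apply/eqP; rewrite -subr_eq0 opprB addrA addrAC; apply/eqP.
apply: (Fp_poly_eq0 p_prime) => [|x].
  exact/size_rising_trunc/prime_gt1.
rewrite !hornerE -[x]opprK -(Fp_natr_val (- x)) horner_rising.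
by rewrite ffact_small ?Fp_val_lt // Fp_natr_val mulr0 Fp_fermat // sub0r addNr.
Qed.

(** The polynomial Q with rising p = X^p - X + p Q; the divisions are exact when
p is prime. *)
Definition wilson_poly (p : nat) : {poly int} :=
  \poly_(k < p) ((rising _ p - 'X^p + 'X)`_k %/ p%:Z)%Z.

Section WilsonPoly.
Variables (p : nat) (p_prime : prime p).

Lemma rising_wilson :
  rising _ p = 'X^p - 'X + p%:R *: wilson_poly p :> {poly int}.
Proof.
suff ->: p%:R *: wilson_poly p = rising _ p - 'X^p + 'X by ring.
apply/polyP=> k; rewrite coefZ coef_poly.
case: ltnP => [_ | le_pk].
  rewrite mulrC natz; apply: divzK.
  rewrite (dvdz_pcharf (pchar_Fp p_prime)) -coef_map.
  rewrite rmorphD rmorphB /= map_rising map_polyXn map_polyX rising_Fp //.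
  by rewrite addrAC subrK subrr coef0.
rewrite mulr0 nth_default // (leq_trans (size_rising_trunc _ _)) //.
exact: prime_gt1.
Qed.

Definition wilson_modp : {poly 'F_p} := map_poly intr (wilson_poly p).

Lemma size_wilson_modp : (size wilson_modp <= p)%N.
Proof. exact: leq_trans (size_poly _ _) (size_poly _ _). Qed.

Lemma wilson_poly0 : (wilson_poly p)`_0 = 0.
Proof.
have p_gt0 := prime_gt0 p_prime.
rewrite coef_poly p_gt0 -(prednK p_gt0) risingS.
by rewrite !(coefD, coefN, coefXM, coefXn, coefX) subr0 addr0 div0z.
Qed.

(** The coefficient of X in the rising factorial is (p-1)!. *)
Lemma wilson_modp1 : wilson_modp`_1 = wilson_quotient p.
Proof.
have p_gt0 := prime_gt0 p_prime; have p_gt1 := prime_gt1 p_prime.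
rewrite coef_map coef_poly p_gt1 /wilson_quotient.
suff ->: (rising int p - 'X^p + 'X)`_1 = ((p.-1)`! + 1)%N.
  by rewrite divz_nat.
rewrite -{1}(prednK p_gt0) risingS !(coefD, coefN, coefXM, coefXn, coefX).
by rewrite -horner_coef0 horner0_rising1 (ltn_eqF p_gt1) subr0 PoszD natz.
Qed.

(** The rising factorial vanishes at -j, so Q(-j) is determined by j^p - j. *)
Lemma horner_wilson_poly j : odd p -> (j < p)%N ->
  p%:R * (wilson_poly p).[- j%:R] = j%:R ^+ p - j%:R.
Proof.
move=> p_odd lt_jp; have := congr1 (horner^~ (- j%:R)) rising_wilson.
rewrite horner_rising ffact_small // mulr0.
rewrite !(hornerD, hornerN, hornerZ, hornerXn, hornerX) exprNn -signr_odd p_odd.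
by move=> E; apply/eqP; rewrite -subr_eq0 [X in _ == X]E; apply/eqP; ring.
Qed.

(** Adding the values at -j and -(p-j) leaves (j^p + (p-j)^p)/p - 1, and
j^p + (p-j)^p is divisible by p^2: it factors as p times a sum Y of p terms all
congruent to j^(p-1). *)
Lemma horner_wilson_modp_sym (j : nat) : odd p -> (0 < j < p)%N ->
  wilson_modp.[j%:R] + wilson_modp.[- j%:R] = -1.
Proof.
move=> p_odd /andP[j_gt0 lt_jp]; have p_gt0 := prime_gt0 p_prime.
have e1 : (p - j)%N%:R%:~R = - j%:R :> 'F_p.
  apply/eqP; rewrite rmorph_nat -addr_eq0 -natrD subnK ?(ltnW lt_jp) //.
  exact/eqP/Fp_natr0.
have e2 : (- j%:R)%:~R = - j%:R :> 'F_p by rewrite rmorphN /= rmorph_nat.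
pose Y : int := \sum_(i < p) (p - j)%N%:R ^+ (p.-1 - i) * (- j%:R) ^+ i.
have DY : (wilson_poly p).[- (p - j)%N%:R] + (wilson_poly p).[- j%:R] = Y - 1.
  have p_neq0 : (p%:R : int) != 0 by rewrite pnatr_eq0 -lt0n.
  apply: (mulfI p_neq0); rewrite mulrDr !horner_wilson_poly //; last first.
    by rewrite ltn_subrL j_gt0.
  rewrite mulrBr; have <- : (p - j)%N%:R ^+ p - (- j%:R) ^+ p = p%:R * Y.
    by rewrite subrXX opprK -natrD subnK // ltnW.
  rewrite [in RHS]exprNn -signr_odd p_odd natrB ?(ltnW lt_jp) //; ring.
have Y0 : Y%:~R = 0 :> 'F_p.
  rewrite rmorph_sum (eq_bigr (fun=> (- j%:R) ^+ p.-1)) => [|i _].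
    by rewrite sumr_const card_ord; apply: mulrn_pchar (pchar_Fp p_prime) _.
  by rewrite rmorphM !rmorphXn /= e1 e2 -exprD subnK // -ltnS prednK.
have horner_intr (a : int) : wilson_modp.[a%:~R] = (wilson_poly p).[a]%:~R.
  by rewrite horner_map.
have -> : wilson_modp.[j%:R] = (wilson_poly p).[- (p - j)%N%:R]%:~R.
  by rewrite -horner_intr rmorphN /= e1 opprK.
have -> : wilson_modp.[- j%:R] = (wilson_poly p).[- j%:R]%:~R.
  by rewrite -horner_intr e2.
by rewrite -rmorphD DY rmorphB /= Y0 sub0r.
Qed.

(** The two sides agree at every point of the field and have degree less than
p. *)
Lemma wilson_modp_sym :
  odd p -> wilson_modp + (wilson_modp \Po (- 'X)) = - 'X^(p.-1).
Proof.
move=> p_odd; apply/eqP; rewrite -addr_eq0; apply/eqP.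
have p_gt0 := prime_gt0 p_prime; have p_gt1 := prime_gt1 p_prime.
apply: (Fp_poly_eq0 p_prime) => [|x].
  apply: leq_trans (size_polyD _ _) _; rewrite geq_max size_polyXn prednK //.
  rewrite leqnn andbT. apply: leq_trans (size_polyD _ _) _.
  by rewrite geq_max size_comp_poly2 ?size_polyN ?size_polyX ?size_wilson_modp.
rewrite !(hornerD, horner_comp, hornerN, hornerX, hornerXn).
have [-> | x0] := eqVneq x 0.
  rewrite oppr0 horner_coef0 coef_map wilson_poly0 /= mulr0z !add0r.
  by rewrite expr0n -subn1 subn_eq0 leqNgt p_gt1.
rewrite -(Fp_natr_val x) horner_wilson_modp_sym //; last first.
  by rewrite Fp_val_lt // andbT lt0n.
rewrite Fp_natr_val; apply: (mulIf x0).
by rewrite mulrDl -exprSr prednK // Fp_fermat // mulN1r addNr mul0r.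
Qed.

(** Divide the derivative of R(x+1) - R(x) = p R(x)/x by p over Z, and reduce:
R(x)/x becomes x^(p-1) - 1, whose derivative is - x^(p-2).  The powers
(x+1)^(p-1) - x^(p-1) come from the x^p in R; they are absorbed by
the term x^(p-1) of G. *)
Lemma wilson_modp_shift :
  let G := 'X^(p.-1) + wilson_modp^`() in
  G \Po ('X + 1) - G = - 'X^(p.-2).
Proof.
have p_gt0 := prime_gt0 p_prime; have p_gt1 := prime_gt1 p_prime => G.
pose D := (wilson_poly p) \Po ('X + 1) - wilson_poly p.
have E : p%:R *: (('X + 1) ^+ p.-1 - 'X^(p.-1) + D^`()) =
    p%:R *: (rising1 int p.-1)^`().
  have := rising_diff int p.-1; rewrite prednK // rising_wilson.
  move/(congr1 (@deriv _)); rewrite derivZ => <-.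
  rewrite comp_polyD comp_polyB comp_polyX comp_Xn_poly comp_polyZ.
  by rewrite /D !derivE deriv_exp !derivE !scaler_nat; ring.
have {}E : ('X + 1) ^+ p.-1 - 'X^(p.-1) + D^`() = (rising1 int p.-1)^`().
  apply/polyP=> k; have /(congr1 (coefp k)) /= := E.
  by rewrite !coefZ; apply: mulfI; rewrite pnatr_eq0 -lt0n.
have Erising1 : rising1 'F_p p.-1 = 'X^(p.-1) - 1.
  apply: (@mulfI _ 'X); first by rewrite polyX_eq0.
  by rewrite -risingS prednK // rising_Fp // mulrBr mulr1 -exprS prednK.
have := congr1 (map_poly (intr : int -> 'F_p)) E.
rewrite -deriv_map map_rising1 Erising1.
have -> : ('X^(p.-1) - 1)^`() = - 'X^(p.-2) :> {poly 'F_p}.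
  apply/eqP; rewrite !derivE subr0 -addr_eq0 -mulrSr prednK // -scaler_nat.
  apply/eqP/polyP=> k; rewrite coefZ coef0.
  by rewrite [X in X * _](Fp_natr0 p_prime) mul0r.
have phiX1 : map_poly (intr : int -> 'F_p) ('X + 1) = 'X + 1.
  by rewrite rmorphD /= map_polyX rmorph1.
move=> <-; rewrite /D /G [in RHS]rmorphD [in RHS]rmorphB /=.
rewrite rmorphXn /= phiX1 map_polyXn -deriv_map [map_poly _ (_ - _)]rmorphB /=.
rewrite map_comp_poly phiX1.
rewrite -/wilson_modp derivB deriv_comp comp_polyD comp_Xn_poly !derivE.
ring.
Qed.

End WilsonPoly.

(** * Bernoulli numbers modulo p *)

(** Both sides are the multinomial m! / (n! i! (m-n-i)!). *)
Lemma bin_trinomial m n i :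
  (n + i <= m -> 'C(m, n) * 'C(m - n, i) = 'C(m, i) * 'C(m - i, n))%N.
Proof.
move=> le_m; have le_nm := leq_trans (leq_addr i n) le_m.
have le_im := leq_trans (leq_addl n i) le_m.
have le_i : (i <= m - n)%N by rewrite leq_subRL // addnC in le_m *.
have le_n : (n <= m - i)%N by rewrite leq_subRL // addnC.
apply/eqP; rewrite -(@eqn_pmul2r (n`! * i`! * (m - n - i)`!)); last first.
  by rewrite !muln_gt0 !fact_gt0.
have E1 := bin_fact le_nm; have E2 := bin_fact le_i.
have E3 := bin_fact le_im; have E4 := bin_fact le_n.
rewrite -subnDA addnC subnDA in E4.
have -> : ('C(m, n) * 'C(m - n, i) * (n`! * i`! * (m - n - i)`!) =
  'C(m, n) * (n`! * ('C(m - n, i) * (i`! * (m - n - i)`!))))%N by ring.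
rewrite E2 E1.
have -> : ('C(m, i) * 'C(m - i, n) * (n`! * i`! * (m - n - i)`!) =
  'C(m, i) * (i`! * ('C(m - i, n) * (n`! * (m - n - i)`!))))%N by ring.
by rewrite E4 E3.
Qed.

Section BernoulliModP.
Variables (p : nat) (p_prime : prime p).

(** The difference equation of G identifies its coefficient at X^(p-1-n) with
C(p-1, n) B_n, and C(p-1, n) = (-1)^n modulo p. *)
Definition bernoulli_modp n : 'F_p :=
  (-1) ^+ n * ('X^(p.-1) + (wilson_modp p)^`())`_(p.-1 - n).

(** Take the coefficient of X^k, k = p-1-(n+1), in G(x+1) - G(x) = - x^(p-2).
By bin_trinomial all its terms share the factor C(p-1, k) = (-1)^k. *)
Lemma bernoulli_modp_rec n : (n.+1 < p)%N ->
  \sum_(i < n.+1) 'C(n.+1, i)%:R * bernoulli_modp i = (n == 0)%:R.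
Proof.
move=> lt_np; have p_gt0 := prime_gt0 p_prime.
pose k := (p.-1 - n.+1)%N; pose G := 'X^(p.-1) + (wilson_modp p)^`().
have le_np : (n.+1 <= p.-1)%N by rewrite -ltnS prednK.
have szG : (size G <= p)%N.
  rewrite /G; apply: leq_trans (size_polyD _ _) _.
  rewrite geq_max size_polyXn prednK // leqnn.
  rewrite (leq_trans (size_poly _ _)) // (leq_trans (leq_pred _)) //.
  exact: size_wilson_modp.
have := congr1 (coefp k) (wilson_modp_shift p_prime); rewrite -/G /=.
rewrite coefB (coef_comp_add1 _ szG) coefN coefXn.
(* Index i now stands for the coefficient of degree p-1-i, which does not
   reach X^k when i > n+1. *)
rewrite (reindex_inj rev_ord_inj) /=.
pose F i := G`_(p.-1 - i) * 'C(p.-1 - i, k)%:R.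
rewrite (eq_bigr (fun i : 'I_p => F i)) => [|i _]; last first.
  by rewrite /F subnS -subn1 subnAC subn1.
have -> : \sum_(i < p) F i = \sum_(i < n.+2) F i.
  rewrite (big_ord_widen _ F lt_np) [RHS]big_mkcond; apply: eq_bigr => i _.
  case: ltnP => // lt_ni; rewrite /F bin_small ?mulr0 // /k.
  by have := ltn_ord i; lia.
rewrite big_ord_recr /= /F -/k binn mulr1 addrK.
have -> : \sum_(i < n.+1) G`_(p.-1 - i) * 'C(p.-1 - i, k)%:R =
    (-1) ^+ k * \sum_(i < n.+1) 'C(n.+1, i)%:R * bernoulli_modp i.
  rewrite mulr_sumr; apply: eq_bigr => i _.
  have lt_kp : (k < p)%N by rewrite -(prednK p_gt0) ltnS leq_subr.
  have lt_ip : (i < p)%N by apply: leq_trans (ltn_ord i) (ltnW lt_np).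
  have -> : G`_(p.-1 - i) = 'C(p.-1, i)%:R * bernoulli_modp i.
    by rewrite Fp_bin_pred // /bernoulli_modp signrMK.
  rewrite mulrAC -natrM bin_trinomial; last first.
    by rewrite /k; have := ltn_ord i; lia.
  have -> : (p.-1 - k = n.+1)%N by rewrite subKn.
  by rewrite natrM Fp_bin_pred // -mulrA.
move=> E; rewrite -[LHS](signrMK k) E.
rewrite /k; clear E F k; case: n lt_np le_np => [|n] lt_np le_np.
  rewrite subn1 eqxx mulrN1 -mulN1r -exprS prednK // -Fp_bin_pred ?binn //.
  by rewrite prednK.
by rewrite ltn_eqF ?oppr0 ?mulr0 //; lia.
Qed.

Lemma reduces_bernoulli n : (n.+1 < p)%N ->
  reduces p (bernoulli n) (bernoulli_modp n).
Proof.
elim/ltn_ind: n => n IH lt_np.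
have := bernoulli_rec n; rewrite big_ord_recr /= binSn => E.
have := bernoulli_modp_rec lt_np; rewrite big_ord_recr /= binSn => E'.
have n0 : n.+1%:R != 0 :> 'F_p by apply: Fp_natr_neq0.
have -> : bernoulli n =
    ((n == 0)%:R - \sum_(i < n) 'C(n.+1, i)%:R * bernoulli i) / n.+1%:R.
  by rewrite -E addrAC subrr add0r mulrC mulKf // pnatr_eq0.
have -> : bernoulli_modp n =
    ((n == 0)%:R - \sum_(i < n) 'C(n.+1, i)%:R * bernoulli_modp i) / n.+1%:R.
  by rewrite -E' addrAC subrr add0r mulrC mulKf.
apply: reducesM (reducesV n0 (reduces_nat _ _)); apply: reducesB.
  exact: reduces_nat.
apply: reduces_sum => i _; apply: reducesM; first exact: reduces_nat.
by apply: IH => //; have := ltn_ord i; lia.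
Qed.

Lemma red_modp_bernoulli k : odd p -> (1 < k < p)%N ->
  red_modp p (bernoulli (p - k)) / k%:R = (-1) ^+ k.+1 * (wilson_modp p)`_k.
Proof.
move=> p_odd /andP[k_gt1 lt_kp]; have k_gt0 := ltnW k_gt1.
rewrite (reduces_red_modp (reduces_bernoulli _)); last first.
  by lia.
apply: (canLR (mulfK _)); first by rewrite Fp_natr_neq0 // k_gt0.
rewrite /bernoulli_modp. have -> : (p.-1 - (p - k) = k.-1)%N by lia.
rewrite coefD coefXn coef_deriv prednK // ltn_eqF; last by lia.
rewrite add0r mulrnAr -[LHS]mulr_natr; congr (_ * _ * _).
rewrite -signr_odd -[RHS]signr_odd oddB ?(ltnW lt_kp) // p_odd /=.
by case: (odd k).
Qed.

End BernoulliModP.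

(** * Moments of the truncated Artin-Hasse coefficients *)

Section Moments.
Variable p : nat.

(** Term of index i in the coefficient of Y^r of the product of
sum_i (-ip)^m Y^i / (ip)! and exp(Y/p). *)
Definition moment_term m r i : rat :=
  (- (i * p)%:R) ^+ m / (i * p)`!%:R / (p ^ (r - i) * (r - i)`!)%:R.

Definition moment m r : rat := \sum_(i < r.+1) moment_term m r i.

Lemma moment_S0 m : moment m.+1 0 = 0.
Proof. by rewrite /moment big_ord1 /moment_term mul0n oppr0 expr0n !mul0r. Qed.

Lemma moment00 : moment 0 0 = 1.
Proof. by rewrite /moment big_ord1 /moment_term mul0n subn0 !divr1. Qed.

Hypothesis p_gt0 : (0 < p)%N.

Lemma moment_termS m r i : (i <= r)%N ->
  moment_term m r i = p%:R * (r.+1 - i)%:R * moment_term m r.+1 i.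
Proof.
move=> le_ir; rewrite /moment_term subSn // expnS factS.
have p0 : p%:R != 0 :> rat by rewrite pnatr_eq0 -lt0n.
have s0 : (r - i).+1%:R != 0 :> rat by rewrite pnatr_eq0.
have q0 : (p ^ (r - i))%:R != 0 :> rat.
  by rewrite pnatr_eq0 -lt0n expn_gt0 p_gt0.
have f0 : (r - i)`!%:R != 0 :> rat by rewrite pnatr_eq0 -lt0n fact_gt0.
have g0 : (i * p)`!%:R != 0 :> rat by rewrite pnatr_eq0 -lt0n fact_gt0.
by rewrite !natrM; field; rewrite nat1r p0 s0 q0 f0 g0.
Qed.

(** Split the extra factor as -ip = (r+1-i) p - (r+1) p: the first part lowers
the denominator of the exp(Y/p) factor from r+1-i to r-i. *)
Lemma momentS m r :
  moment m.+1 r.+1 = moment m r - p%:R * r.+1%:R * moment m r.+1.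
Proof.
have termE s i : moment_term m.+1 s i = - (i * p)%:R * moment_term m s i.
  by rewrite /moment_term exprS !mulrA.
rewrite /moment mulr_sumr 2![\sum_(_ < r.+2) _]big_ord_recr /= opprD addrA.
rewrite -sumrB.
rewrite termE natrM mulNr [r.+1%:R * _]mulrC; congr (_ - _).
apply: eq_bigr => i _; have le_ir : (i <= r)%N by rewrite -ltnS.
by rewrite termE (moment_termS _ le_ir) natrB ?leqW // natrM; ring.
Qed.

(** Weighting by R(-ip) = -(ip)!/(ip-p)! shifts 1/(ip)! to 1/((i-1)p)!. *)
Lemma moment_rising r : odd p ->
  \sum_(k < p.+1) (rising rat p)`_k * moment k r.+1 = - moment 0 r.
Proof.
move=> p_odd; pose x i : rat := - (i * p)%:R.
transitivity (\sum_(i < r.+2) (rising rat p).[x i] * moment_term 0 r.+1 i).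
  under eq_bigr => k _ do rewrite mulr_sumr.
  rewrite exchange_big; apply: eq_bigr => i _ /=.
  rewrite horner_coef size_rising mulr_suml; apply: eq_bigr => k _.
  by rewrite /moment_term -/(x i) expr0 !mulrA mulr1.
rewrite big_ord_recl /x horner_rising mul0n ffact_small // mulr0 mul0r add0r.
rewrite /moment -sumrN; apply: eq_bigr => i _.
have le_p : (p <= i.+1 * p)%N by rewrite mulSn leq_addr.
rewrite horner_rising -signr_odd p_odd mulN1r mulNr /= /bump add1n; congr (- _).
rewrite /moment_term subSS !expr0 !mulrA mulr1; congr (_ / _).
rewrite -(ffact_fact le_p) natrM mulSn addKn invfM mulrA divff ?mul1r //.
by rewrite pnatr_eq0 -lt0n ffact_gt0 leq_addr.
Qed.

End Moments.

(** Since rp < p^2, the terms of the logarithm beyond X + X^p/p are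
irrelevant; the binomial theorem then separates exp(X) from exp(X^p/p). *)
Lemma AH_coef_moment p r : prime p -> (r < p)%N ->
  AH_coef p (r * p) = moment p 0 r.
Proof.
move=> p_prime lt_rp; have p_gt1 := prime_gt1 p_prime; have p_gt0 := ltnW p_gt1.
pose n := (r * p)%N; pose L : {poly rat} := 'X + p%:R^-1 *: 'X^p.
rewrite -(AH_truncE p_gt1 (leqnSn n)) -/n.
have [Z DL] : exists Z, AH_log_trunc p n.+1 = L + Z * 'X^(n.+1).
  exists (\sum_(i < n) ((p ^ i.+2)%N%:R)^-1 *: 'X^(p ^ i.+2 - n.+1)).
  rewrite /AH_log_trunc !big_ord_recl expn0 invr1 scale1r expr1 addrA.
  congr (_ + _).
  rewrite mulr_suml; apply: eq_bigr => i _.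
  rewrite -scalerAl -exprD subnK // /n.
  apply: (@leq_trans (p ^ 2)); last by rewrite leq_pexp2l.
  by rewrite -mulnn ltn_pmul2r.
have DLj j : (j < n.+2)%N -> (AH_log_trunc p n.+1 ^+ j)`_n =
    \sum_(l < n.+2) 'C(j, l)%:R * (p%:R ^- l * (n == j - l + p * l)%N%:R).
  move=> lt_jn; have -> : (AH_log_trunc p n.+1 ^+ j)`_n = (L ^+ j)`_n.
    apply/eqP; rewrite -subr_eq0 -coefB subrXX DL addrC addKr.
    by rewrite -mulrA -commr_polyXn mulrA coefMXn ltnSn.
  pose T l : rat := 'C(j, l)%:R * (p%:R ^- l * (n == j - l + p * l)%N%:R).
  transitivity (\sum_(l < j.+1) T l).
    rewrite exprDn coef_sum; apply: eq_bigr => l _.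
    rewrite /T mulr_natl coefMn exprZn -exprM -scalerAr -exprD coefZ coefXn.
    by rewrite exprVn.
  rewrite (big_ord_widen _ T lt_jn) big_mkcond; apply: eq_bigr => l _.
  by case: ltnP => // lt_jl; rewrite bin_small ?mul0r.
rewrite coef_sum; under eq_bigr => j _ do rewrite coefZ DLj // mulr_sumr.
rewrite exchange_big /=.
pose F l : rat := (p ^ l * l`!)%:R^-1 / ((r - l) * p)`!%:R.
transitivity (\sum_(l < r.+1) F l).
  have le_rn : (r.+1 <= n.+2)%N by rewrite ltnS leqW // leq_pmulr.
  rewrite (big_ord_widen _ F le_rn) [RHS]big_mkcond; apply: eq_bigr => l _.
  case: ltnP => [lt_lr | le_rl]; last first.
    rewrite big1 // => j _.
    suff /negPf-> : n != (j - l + p * l)%N by rewrite !mulr0.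
    by rewrite neq_ltn ltn_addl // [X in (X < _)%N]mulnC ltn_pmul2l.
  (* The j-th power of L contributes in degree rp, with exponent l on X^p, only
     for j = j0. *)
  pose j0 := ((r - l) * p + l)%N.
  have Dlp : ((r - l) * p + l * p = n)%N by rewrite -mulnDl subnK.
  have lt_j0 : (j0 < n.+2)%N.
    by rewrite ltnS leqW // -[X in (_ <= X)%N]Dlp leq_add2l leq_pmulr.
  rewrite (bigD1 (Ordinal lt_j0)) //= big1 ?addr0 => [|j].
    have j0F : j0`!%:R != 0 :> rat by rewrite pnatr_eq0 -lt0n fact_gt0.
    have := @bin_fact j0 l (leq_addl _ _); rewrite {2}/j0 addnK => Dj0.
    rewrite [(p * l)%N]mulnC Dlp eqxx mulr1 mulrA; apply: (mulfI j0F).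
    rewrite !mulrA divff // mul1r.
    rewrite -Dj0 /F !natrM natrX; field.
    by rewrite expf_neq0 ?pnatr_eq0 -?lt0n ?fact_gt0.
  rewrite -val_eqE /= => neq_j; have [lt_jl | le_lj] := ltnP j l.
    by rewrite bin_small // mul0r mulr0.
  suff /negPf-> : n != (j - l + p * l)%N by rewrite !mulr0.
  apply: contraNneq neq_j => E; move: E; rewrite -[LHS]Dlp [(p * l)%N]mulnC.
  by move/addIn=> E; rewrite /j0 E subnK.
rewrite (reindex_inj rev_ord_inj); apply: eq_bigr => i _ /=.
rewrite /F /moment_term subSS subKn ?expr0 ?mul1r; last by rewrite -ltnS.
exact: mulrC.
Qed.

(** This is moment_rising with R = X^p - X + p Q, divided by p. *)
Lemma moment_main p r : prime p -> odd p ->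
  r.+1%:R * moment p 0 r.+1 =
    - (moment p p r.+1 / p%:R)
    - \sum_(k < p) ((wilson_poly p)`_k)%:~R * moment p k r.+1.
Proof.
move=> p_prime p_odd.
have p_gt0 := prime_gt0 p_prime; have p_gt1 := prime_gt1 p_prime.
have p0 : p%:R != 0 :> rat by rewrite pnatr_eq0 -lt0n.
have := moment_rising p_gt0 r p_odd.
have Dk k : (rising rat p)`_k =
    (k == p)%:R - (k == 1)%:R + p%:R * ((wilson_poly p)`_k)%:~R.
  rewrite -map_rising coef_map /= (rising_wilson p_prime) coefD coefB coefXn.
  by rewrite coefX coefZ intrD rmorphB rmorphM /= !rmorph_nat.
under eq_bigr => k _ do rewrite Dk mulrDl mulrBl -mulrA.
rewrite big_split sumrB -mulr_sumr /= big_ord_recr /= eqxx mul1r.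
rewrite big1 => [|k _]; last by rewrite ltn_eqF ?mul0r.
rewrite [X in _ - X](bigD1 (Ordinal (ltnW p_gt1 : 1 < p.+1)%N)) //= mul1r.
rewrite big1 => [|k k1]; last first.
  by rewrite -val_eqE /= in k1; rewrite (negPf k1) mul0r.
rewrite big_ord_recr /= nth_default ?size_poly // mul0r !addr0 add0r momentS //.
set S := \sum_(i < p) _ => E.
(* The left-hand side of E is made to appear inside the p-th moment. *)
have -> : moment p p r.+1 =
    moment p p r.+1 - (moment p 0 r - p%:R * r.+1%:R * moment p 0 r.+1)
    + p%:R * S + moment p 0 r - p%:R * (r.+1%:R * moment p 0 r.+1 + S) by ring.
by rewrite E; field.
Qed.

(** * Integrality and the recursion modulo p *)

Section Integrality.
Variables (p : nat) (p_prime : prime p) (p_odd : odd p).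

Definition integral x := exists y, reduces p x y.

Section Prefix.
Variables (a : nat -> 'F_p) (r : nat).
Hypothesis a_red : forall j, (j <= r)%N -> reduces p (moment p 0 j) (a j).

Let p_gt0 := prime_gt0 p_prime.

(** Modulo p the recursion momentS reads M_(m+1)(j+1) = M_m(j). *)
Lemma reduces_moment m j : (j <= r)%N ->
  reduces p (moment p m j) (if (m <= j)%N then a (j - m)%N else 0).
Proof.
elim: m j => [|m IH] j le_jr; first by rewrite subn0; apply: a_red.
elim: j le_jr => [|j IHj] le_jr.
  by rewrite moment_S0; apply: (reduces_int p 0).
rewrite momentS // ltnS subSS -[if _ then _ else _]subr0.
apply: reducesB; first exact/IH/ltnW.
rewrite -mulrA; apply: (reduces_pmul p_prime).
exact: reducesM (reduces_nat _ _) (IH _ le_jr).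
Qed.

(** For j < m the residue of M_m(j) is zero, so M_m(j) can be divided by p.  The
terms lost modulo p in momentS matter only on the diagonal j + 1 = m, where they
add up to -(1 + 2 + ... + (m-1)).  For m = p this sum is divisible by p. *)
Lemma reduces_moment_div m j : (j <= r)%N -> (j < m)%N ->
  reduces p (moment p m j / p%:R) (- (if j.+1 == m then 'C(m, 2) else 0)%:R).
Proof.
have p0 : p%:R != 0 :> rat by rewrite pnatr_eq0 -lt0n.
have a0 : a 0 = 1.
  apply: reduces_inj (a_red (leq0n r)) _; rewrite moment00.
  exact: (reduces_int p 1).
elim: m j => [|m IH] j le_jr // lt_jm.
case: j le_jr lt_jm => [|j] le_jr lt_jm.
  have -> : (if 1 == m.+1 then 'C(m.+1, 2) else 0)%N = 0%N by case: (m).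
  by rewrite moment_S0 mul0r oppr0; apply: (reduces_int p 0).
rewrite momentS // -mulrA mulrBl [p%:R * _]mulrC mulfK // eqSS.
have -> : - (if j.+1 == m then 'C(m.+1, 2) else 0)%:R =
    - (if j.+1 == m then 'C(m, 2) else 0)%:R
    - j.+1%:R * (if (m <= j.+1)%N then a (j.+1 - m)%N else 0) :> 'F_p.
  case: eqP => [<- | neq_jm].
    by rewrite leqnn subnn a0 binS bin1 natrD; ring.
  rewrite ltnS in lt_jm; rewrite ifN ?mulr0 ?subr0 // -ltnNge.
  by rewrite ltn_neqAle lt_jm andbT; apply/eqP.
apply: reducesB; first by apply: IH; rewrite // ltnW.
by apply: reducesM (reduces_nat _ _) (reduces_moment _ _).
Qed.

End Prefix.

(** The moment relation for r expresses r u, where u = u_(rp), through moments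
that contain u itself.  These occurrences carry a factor p, so that integrality
of u follows once the relation is known to have the form r u = c + p e u with c
and e integral. *)
Definition affine_in u x :=
  exists c e, [/\ integral c, integral e & x = c + p%:R * e * u].

Lemma affine_inD u x y : affine_in u x -> affine_in u y -> affine_in u (x + y).
Proof.
move=> [c [e [[c' Ic] [e' Ie] ->]]] [d [f [[d' Id] [f' If] ->]]].
exists (c + d), (e + f); split; last by ring.
  by eexists; apply: reducesD Ic Id.
by eexists; apply: reducesD Ie If.
Qed.

Lemma affine_inM u k x : integral k -> affine_in u x -> affine_in u (k * x).
Proof.
move=> [k' Ik] [c [e [[c' Ic] [e' Ie] ->]]].
exists (k * c), (k * e); split; last by ring.
  by eexists; apply: reducesM Ik Ic.
by eexists; apply: reducesM Ik Ie.
Qed.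

Lemma affine_inN u x : affine_in u x -> affine_in u (- x).
Proof.
rewrite -mulN1r; apply: affine_inM; exists (-1); exact: (reduces_int p (-1)).
Qed.

Lemma affine_in_integral u x : integral x -> affine_in u x.
Proof.
move=> Ix; exists x, 0; split; rewrite ?mulr0 ?mul0r ?addr0 //.
by exists 0; apply: (reduces_int p 0).
Qed.

Lemma affine_in_pmul u : affine_in u (p%:R * u).
Proof.
exists 0, 1; split; rewrite ?mulr1 ?add0r //.
  by exists 0; apply: (reduces_int p 0).
by exists 1; apply: (reduces_int p 1).
Qed.

Lemma affine_in_solve u s :
  (s%:R : 'F_p) != 0 -> affine_in u (s%:R * u) -> integral u.
Proof.
move=> s0 [c [e [[c' Ic] [e' Ie] E]]].
have R : reduces p (s%:R - p%:R * e) s%:R.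
  rewrite -[X in reduces p _ X]subr0.
  exact: reducesB (reduces_nat _ _) (reduces_pmul p_prime Ie).
have nz : s%:R - p%:R * e != 0.
  apply: contraNneq s0 => E0; rewrite E0 in R.
  by rewrite (reduces_inj R (reduces_int p 0)).
exists (c' / s%:R); have -> : u = c / (s%:R - p%:R * e).
  by apply: (canRL (mulfK nz)); rewrite mulrC mulrBl E; ring.
exact: reducesM Ic (reducesV s0 R).
Qed.

(** The division of M_p(r) by p is the delicate term: one step of momentS reduces
it to M_(p-1)(r-1)/p, integral by induction, and to r M_(p-1)(r), which has
positive index and hence involves u only through a multiple of p. *)
Lemma integral_moment0 r : (r < p)%N -> integral (moment p 0 r).
Proof.
have p_gt0 := prime_gt0 p_prime.
have p0 : p%:R != 0 :> rat by rewrite pnatr_eq0 -lt0n.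
elim/ltn_ind: r => -[|r] IH lt_rp.
  by exists 1; rewrite moment00; apply: (reduces_int p 1).
pose a j := red_modp p (moment p 0 j).
have a_red j : (j <= r)%N -> reduces p (moment p 0 j) (a j).
  move=> le_jr; have [|y Ry] := IH j le_jr.
    exact: leq_ltn_trans (ltnW lt_rp).
  by rewrite /a (reduces_red_modp Ry).
pose u := moment p 0 r.+1.
have aff m : affine_in u (moment p m.+1 r.+1).
  elim: m => [|m IHm].
    rewrite momentS // -mulrA mulrCA -mulNr; apply: affine_inD.
      apply: affine_in_integral; eexists; exact: a_red.
    apply: affine_inM; last exact: affine_in_pmul.
    by exists (- r.+1%:R); apply/reducesN/reduces_nat.
  rewrite momentS // -mulNr; apply: affine_inD.
    apply: affine_in_integral; eexists; exact: (reduces_moment a_red).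
  apply: affine_inM IHm; eexists; apply: reducesN.
  apply: reducesM; exact: reduces_nat.
apply: (@affine_in_solve u r.+1); first by apply: Fp_natr_neq0.
rewrite (moment_main _ p_prime p_odd).
apply: affine_inD; apply: affine_inN.
  have lt_rp1 : (r < p.-1)%N by rewrite -ltnS prednK.
  have -> : moment p p r.+1 / p%:R =
      moment p p.-1 r / p%:R + - r.+1%:R * moment p p.-2.+1 r.+1.
    have -> : p.-2.+1 = p.-1 by case: p.-1 lt_rp1.
    have -> : moment p p r.+1 = moment p p.-1.+1 r.+1 by rewrite prednK.
    by rewrite momentS //; field.
  apply: affine_inD.
    by apply: affine_in_integral; eexists; apply: (reduces_moment_div a_red).
  by apply: affine_inM (aff _); eexists; apply: reducesN; apply: reduces_nat.
elim/big_ind: _ => [||k _].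
- by apply: affine_in_integral; exists 0; apply: (reduces_int p 0).
- exact: affine_inD.
case: k => -[|k] lt_kp /=.
  rewrite (wilson_poly0 p_prime) mul0r; apply: affine_in_integral.
  by exists 0; apply: (reduces_int p 0).
by apply: affine_inM (aff k); eexists; apply: reduces_int.
Qed.

Lemma reduces_AH_coef r : (r < p)%N ->
  reduces p (moment p 0 r) (AH_coef_modp p (r * p)).
Proof.
move=> lt_rp; have [y Ry] := integral_moment0 lt_rp.
by rewrite /AH_coef_modp AH_coef_moment // (reduces_red_modp Ry).
Qed.

Lemma AH_coef_modp0 : AH_coef_modp p 0 = 1.
Proof.
have := reduces_AH_coef (prime_gt0 p_prime); rewrite mul0n moment00 => R.
exact: reduces_inj R (reduces_int p 1).
Qed.

(** Residue of moment_main: M_k(r) becomes a_((r-k)p), and the term M_p(r)/p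
disappears because p divides C(p, 2). *)
Lemma AH_coef_modp_rec r : (r < p)%N ->
  r%:R * AH_coef_modp p (r * p) =
    - \sum_(k < r.+1) (wilson_modp p)`_k * AH_coef_modp p ((r - k) * p).
Proof.
case: r => [|r] lt_rp.
  rewrite mul0r big_ord1 coef_map (wilson_poly0 p_prime) /=.
  by rewrite mulr0z mul0r oppr0.
pose a j := AH_coef_modp p (j * p).
have a_red j : (j <= r.+1)%N -> reduces p (moment p 0 j) (a j).
  by move=> le_jr; apply/reduces_AH_coef/(leq_ltn_trans le_jr).
have R := reducesM (reduces_nat p r.+1) (a_red _ (leqnn _)).
apply: reduces_inj R _; rewrite (moment_main _ p_prime p_odd).
rewrite -[X in reduces p _ X]add0r; apply: reducesB.
  rewrite -[X in reduces p _ X]oppr0; apply: reducesN.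
  have := reduces_moment_div a_red (leqnn _) lt_rp.
  suff -> : - (if r.+2 == p then 'C(p, 2) else 0)%:R = 0 :> 'F_p by [].
  case: eqP => _; last exact: oppr0.
  apply/eqP; rewrite oppr_eq0 -(dvdn_pcharf (pchar_Fp p_prime)).
  by apply: prime_dvd_bin => //; apply: odd_prime_gt2.
pose T k := (wilson_modp p)`_k * (if (k <= r.+1)%N then a (r.+1 - k)%N else 0).
pose T' k := (wilson_modp p)`_k * a (r.+1 - k)%N.
have -> : \sum_(k < r.+2) T' k = \sum_(k < p) T k.
  rewrite (big_ord_widen p T' lt_rp) big_mkcond; apply: eq_bigr => k _.
  by rewrite /T /T' ltnS; case: ifP; rewrite ?mulr0.
apply: reduces_sum => k _; rewrite /T coef_map; apply: reducesM.
  exact: reduces_int.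
exact: (reduces_moment a_red).
Qed.

End Integrality.

(** * The convolution W *)

Section Convolution.
Variables (p : nat) (p_prime : prime p) (p_odd : odd p).

Let p_gt0 := prime_gt0 p_prime.

Definition AH_block : {poly 'F_p} := \poly_(r < p) AH_coef_modp p (r * p).

Lemma AH_block_ode : exists Z,
  'X * AH_block^`() = - (wilson_modp p * AH_block) + Z * 'X^p.
Proof.
pose F := 'X * AH_block^`() + wilson_modp p * AH_block.
exists (drop_poly p F).
rewrite -[LHS](addrK (wilson_modp p * AH_block)) -/F addrC; congr (_ + _).
rewrite -[LHS](poly_take_drop p).
suff -> : take_poly p F = 0 by rewrite add0r.
apply/polyP=> r; rewrite coef_take_poly coef0; case: ifP => // lt_rp.
have -> : F`_r = r%:R * AH_block`_r + (wilson_modp p * AH_block)`_r.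
  rewrite coefD coefXM coef_deriv mulr_natl; case: (r) => //=.
rewrite coef_poly lt_rp AH_coef_modp_rec // coefM addrC.
apply/eqP; rewrite subr_eq0; apply/eqP/eq_bigr => k _.
by rewrite [AH_block`_ _]coef_poly ifT // (leq_ltn_trans (leq_subr _ _)).
Qed.

Definition AH_block_opp : {poly 'F_p} := AH_block \Po (- 'X).

(** Substitute -X in AH_block_ode; X d/dX commutes with this substitution. *)
Lemma AH_block_opp_ode : exists Z,
  'X * AH_block_opp^`() =
    - ((wilson_modp p \Po (- 'X)) * AH_block_opp) + Z * 'X^p.
Proof.
have [Z E] := AH_block_ode; exists (- (Z \Po (- 'X))).
have := congr1 (comp_poly (- 'X)) E.
rewrite comp_polyD comp_polyM comp_polyX raddfN /= !comp_polyM comp_Xn_poly.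
rewrite exprNn -signr_odd p_odd expr1 /AH_block_opp deriv_comp !derivE.
set D := (AH_block^`() \Po _) => E'.
have -> : 'X * (D * -1) = - 'X * D by ring.
rewrite E'; ring.
Qed.

(** M = A(x) A(-x) satisfies x M' = - (Q(x) + Q(-x)) M = x^(p-1) M modulo x^p, so
j M_j = 0 for j < p - 1. *)
Lemma AH_block_even_coef j : (0 < j < p.-1)%N ->
  (AH_block * AH_block_opp)`_j = 0.
Proof.
case/andP=> j_gt0 lt_jp; pose M := AH_block * AH_block_opp.
have lt_jp' : (j < p)%N by apply: leq_trans lt_jp (leq_pred p).
have [Z E] := AH_block_ode; have [Z1 E1] := AH_block_opp_ode.
have EM : 'X * M^`() =
    'X^(p.-1) * M + (Z * AH_block_opp + Z1 * AH_block) * 'X^p.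
  rewrite derivM mulrDr mulrA [X in _ + X]mulrCA E E1.
  by rewrite -['X^(p.-1)]opprK -(wilson_modp_sym p_prime p_odd) /M; ring.
have := congr1 (coefp j) EM; rewrite /=.
rewrite coefD coefMXn coefXnM lt_jp lt_jp' addr0 coefXM (gtn_eqF j_gt0).
rewrite coef_deriv prednK // -mulr_natl => /eqP.
by rewrite mulf_eq0 (negPf (Fp_natr_neq0 p_prime _)) ?j_gt0 // => /eqP.
Qed.

(** W_k is the coefficient of x^k in A(x) x d/dx A(-x) = - Q(-x) A(x) A(-x).  As
Q(0) = 0, only the coefficients of A(x) A(-x) up to degree k - 1 <= p - 2 occur,
and among these only the constant one is nonzero. *)
Lemma W_wilson_modp k :
  (0 < k < p)%N -> W p k = (-1) ^+ k.+1 * (wilson_modp p)`_k.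
Proof.
case/andP=> k_gt0 lt_kp.
have -> : W p k = (AH_block * ('X * AH_block_opp^`()))`_k.
  rewrite coefMr; apply: eq_bigr => r _.
  have -> : ('X * AH_block_opp^`())`_r = r%:R * AH_block_opp`_r.
    by rewrite coefXM coef_deriv mulr_natl; case: (nat_of_ord r).
  have le_rk : (r <= k)%N by rewrite -ltnS.
  rewrite coef_comp_opp !coef_poly (leq_ltn_trans le_rk lt_kp).
  by rewrite (leq_ltn_trans (leq_subr _ _) lt_kp); ring.
have [Z ->] := AH_block_opp_ode.
set Q := wilson_modp p \Po (- 'X).
have -> : AH_block * (- (Q * AH_block_opp) + Z * 'X^p) =
    - (Q * (AH_block * AH_block_opp)) + (AH_block * Z) * 'X^p by ring.
rewrite coefD coefMXn lt_kp addr0 coefN coefM big_ord_recr /= subnn.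
rewrite big1 ?add0r => [|i _].
  have A0 : AH_block`_0 = 1 by rewrite coef_poly p_gt0 mul0n AH_coef_modp0.
  by rewrite coef0M !coef_comp_opp A0 exprS; ring.
rewrite coef_comp_opp; have [i0 | i_gt0] := posnP i.
  by rewrite i0 coef_map (wilson_poly0 p_prime) /= mulr0z mulr0 mul0r.
by rewrite AH_block_even_coef ?mulr0 //; have := ltn_ord i; lia.
Qed.

End Convolution.

Theorem mainTheorem2 (p : nat) (p_prime : prime p) (p_odd : odd p) :
  W p 1 = wilson_quotient p /\
  (forall k : nat, (1 < k < p)%N ->
     W p k = red_modp p (bernoulli (p - k)) / k%:R).
Proof.
split=> [|k k_bounds].
  rewrite W_wilson_modp ?prime_gt1 // wilson_modp1 //.
  by rewrite sqrrN expr1n mul1r.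
rewrite W_wilson_modp // ?red_modp_bernoulli //.
by case/andP: k_bounds => /ltnW->.
Qed.
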